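(* Let $G=(V,E)$ be a finite undirected graph with $N=|V|$ nodes whose node set is partitioned into a set $\mathcal{C}$ of categories, let $A,B\in\mathcal{C}$ with $A\neq B$, and let $S$ be a uniform independence sample of size $n$ from $V$. For the category size estimators $|\widehat{A}|$ and $|\widehat{B}|$ one can employ, as needed, either the induced-subgraph formula $$|\widehat{C}|=N\cdot\frac{|S_C|}{|S|}$$ or the star formula $$|\widehat{C}|=N\cdot\widehat{f}^{\mathrm{vol}}_C\cdot\frac{\widehat{k}_V}{\widehat{k}_C},$$ where $\widehat{k}_V=\frac{\sum_{v\in S}\deg(v)}{|S|}$, $\widehat{k}_C=\frac{\sum_{v\in S_C}\deg(v)}{|S_C|}$, $\widehat{f}^{\mathrm{vol}}_C=\frac{1}{\mathrm{vol}(S)}\sum_{s\in S}\sum_{v\in\mathcal{N}(s)}1_{\{v\in C\}}$ (with $C=A$ or $C=B$). Then the star estimator of the category edge weight $$\widehat{\mathrm{w}}(A,B)=\frac{\sum_{a\in S_A}|E_{a,B}|+\sum_{b\in S_B}|E_{b,A}|}{|S_A|\cdot|\widehat{B}|+|S_B|\cdot|\widehat{A}|}$$ is consistent for $\mathrm{w}(A,B)=\dfrac{|E_{A,B}|}{|A|\cdot|B|}$, i.e. $\widehat{\mathrm{w}}(A,B)\to\mathrm{w}(A,B)$ in probability as $n\to\infty$.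
   Context: $E_{A,B}=\{\{u,v\}\in E: u\in A,\ v\in B\}$ is the edge-cut between $A$ and $B$; for a node $a$ and a category $B$, $E_{a,B}$ is the set of all edges of $G$ between $a$ and $B$. Uniform independence sampling (UIS): nodes are drawn independently and with replacement from $V$, each node having the same sampling probability; $S$ is the resulting multiset of $n=|S|$ nodes, and all sums over and sizes of sub-multisets of $S$ count multiplicity. For a category $C$, $S_C=\{v\in S: v\in C\}$. $\mathcal{N}(s)$ is the set of neighbors of $s$, $\deg(s)$ is the degree of $s$, and $\mathrm{vol}(S)=\sum_{s\in S}\deg(s)$. The assumption made for consistency under uniform sampling is that the relevant means and variances are finite, which holds for finite graphs. $G$ and $N$ are fixed. *)

(* Defs.v *)
From HB Require Import structures.
From mathcomp Require Import all_boot all_order all_algebra.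
From mathcomp Require Import all_classical all_reals all_analysis.
Import Order.TTheory GRing.Theory Num.Theory numFieldNormedType.Exports.

Set Implicit Arguments.
Unset Strict Implicit.
Unset Printing Implicit Defensive.

Local Open Scope ring_scope.

(* Graphs are given by a finite type V of nodes and a set E of edges, each
   edge being an unordered pair of distinct nodes. *)
Section Graph.
Variables (V : finType) (E : {set {set V}}).
Implicit Types (A B : {set V}) (s v : V).

Definition simple_graph := forall e : {set V}, e \in E -> #|e| = 2%N.

Definition neighbors s : {set V} := [set v | [set s; v]%SET \in E]%SET.

Definition degree s : nat := #|[set e in E | s \in e]%SET|.

Definition edge_cut A B : {set {set V}} :=
  [set e in E | [exists u in A, exists v in B, e == [set u; v]%SET]]%SET.

End Graph.

(* A sample is a multiset of nodes, represented by a sequence: [filter], [size]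
   and sums over the sequence count multiplicity. *)
Section Estimators.
Variables (R : realType) (V : finType) (E : {set {set V}}).
Implicit Types (A B C : {set V}) (S : seq V).

Definition subsample S C : seq V := [seq v <- S | v \in C].

Definition vol S : nat := (\sum_(s <- S) degree E s)%N.

(* Division is total with x / 0 = 0, which gives a value to the estimators on
   the samples for which a denominator vanishes (in particular when
   [subsample S C] is empty or all its nodes are isolated). *)

Definition mean_degree S : R := (vol S)%:R / (size S)%:R.

Definition mean_degree_in S C : R :=
  (\sum_(v <- subsample S C) degree E v)%N%:R / (size (subsample S C))%:R.

Definition vol_fraction S C : R :=
  (vol S)%:R^-1 * (\sum_(s <- S) \sum_(v in neighbors E s) (v \in C))%N%:R.

Inductive size_formula := InducedSize | StarSize.

Definition size_estimator (k : size_formula) S C : R :=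
  match k with
  | InducedSize => #|V|%:R * ((size (subsample S C))%:R / (size S)%:R)
  | StarSize =>
      #|V|%:R * vol_fraction S C * (mean_degree S / mean_degree_in S C)
  end.

Definition edge_weight A B : R := #|edge_cut E A B|%:R / (#|A|%:R * #|B|%:R).

(* [kA] and [kB] select the formulas used for the sizes of A and B. *)
Definition edge_weight_estimator (kA kB : size_formula) A B S : R :=
  (\sum_(a <- subsample S A) #|edge_cut E [set a]%SET B|
   + \sum_(b <- subsample S B) #|edge_cut E [set b]%SET A|)%N%:R
  / ((size (subsample S A))%:R * size_estimator kB S B
     + (size (subsample S B))%:R * size_estimator kA S A).

End Estimators.

Local Open Scope classical_set_scope.

Section Sampling.
Context (d : measure_display) (T : measurableType d) (R : realType).
Variable P : probability T R.

(* The finite type V carries the discrete sigma-algebra. *)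
Definition random_element (V : finType) (X : T -> V) :=
  forall B : {set V}, measurable (X @^-1` [set` B]).

Definition uniformly_distributed (V : finType) (X : T -> V) :=
  forall v : V, P (X @^-1` [set v]) = (#|V|%:R^-1)%:E.

Definition mutually_independent (V I : finType) (X : I -> T -> V) :=
  forall (J : {set I}) (B : I -> {set V}),
    P (\bigcap_(i in [set` J]) (X i @^-1` [set` B i]))
    = (\prod_(i in J) P (X i @^-1` [set` B i]))%E.

(* Uniform independence sample of size n: n independent uniform draws, with
   replacement, from V. *)
Definition uniform_independence_sample (V : finType) (n : nat)
    (S : T -> n.-tuple V) :=
  let draw (i : 'I_n) (t : T) : V := tnth (S t) i in
  [/\ forall i, random_element (draw i),
      forall i, uniformly_distributed (draw i)
    & mutually_independent draw].

Definition converges_in_probability (X : nat -> T -> R) (l : R) :=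
  forall eps : R, 0 < eps ->
    (fun n => P [set t | eps < `|X n t - l|]) @ \oo --> 0%E.

End Sampling.

(* Main.v *)
Require Import Defs.
From HB Require Import structures.
From mathcomp Require Import all_boot all_order all_algebra.
From mathcomp Require Import all_classical all_reals all_analysis.
From mathcomp Require Import ring.
Import Order.TTheory GRing.Theory Num.Theory numFieldNormedType.Exports.

Set Implicit Arguments.
Unset Strict Implicit.
Unset Printing Implicit Defensive.

(** Under uniform independence sampling the sample is uniformly distributed
    over all n-tuples of nodes, so Chebyshev's inequality gives a weak law of
    large numbers for the sample mean of any function of the nodes.  After
    division by |S|, the numerator and the denominator of the estimator are
    built from such means; they converge to 2|E_(A,B)|/N and 2|A||B|/N,
    because double counting gives sum_s |N(s) :&: C| = vol(C) and
    sum_(a in A) |E_(a,B)| = |E_(A,B)|.  The star formula needs vol(C) > 0;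
    this can only fail when E_(A,B) is empty, and then the numerator is 0 on
    every sample. *)

(** * Degrees, neighbourhoods and edge cuts *)

Section Graph.
Variables (V : finType) (E : {set {set V}}).
Hypothesis simpleE : simple_graph E.
Implicit Types (A B C : {set V}) (s v : V).

Lemma neighborsC s v : (v \in neighbors E s) = (s \in neighbors E v).
Proof. by rewrite !inE finset.setUC. Qed.

(** The map sending [v] to the pair of [s] and [v] is a bijection from the neighbours of [s] to the
    edges through [s]; injectivity uses that an edge has two distinct ends. *)
Lemma card_neighbors s : #|neighbors E s| = degree E s.
Proof.
have neq v : [set s; v]%SET \in E -> s != v.
  by move=> /simpleE; rewrite cards2; case: eqVneq.
rewrite /degree -(card_in_imset (f := fun v => [set s; v]%SET)); last first.
  move=> u v; rewrite !inE => /neq su /neq sv /setP /(_ u).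
  by rewrite !inE eqxx orbT (eq_sym u s) (negPf su) => /esym/eqP.
congr #|pred_of_set _|; apply/setP => e; rewrite !inE.
apply/imsetP/andP => [[v]|[eE se]].
  by rewrite inE => svE ->; rewrite svE set21.
have /eqP/cards2P[x [y [xy exy]]] := simpleE eE.
move: se; rewrite exy !inE => /orP[] /eqP ->.
  by exists y => //; rewrite inE -exy.
by exists x; rewrite 1?inE finset.setUC -?exy.
Qed.

(** After exchanging the sums, each [c] in [C] is counted once for every [s] adjacent to it. *)
Lemma sum_neighbors_in C :
  (\sum_s \sum_(v in neighbors E s) (v \in C) = \sum_(c in C) degree E c)%N.
Proof.
under eq_bigr do rewrite big_mkcond.
rewrite exchange_big [RHS]big_mkcond; apply: eq_bigr => c _ /=.
case: ifP => _; last by rewrite big1// => i _; rewrite if_same.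
rewrite -card_neighbors -sum1_card [RHS]big_mkcond; apply: eq_bigr => s _.
by rewrite neighborsC.
Qed.

Lemma edge_cutC A B : edge_cut E A B = edge_cut E B A.
Proof.
apply/setP => e; rewrite !inE; congr (_ && _).
by apply/exists_inP/exists_inP => -[u uA /exists_inP[v vB /eqP ->]];
  exists v => //; apply/exists_inP; exists u => //; rewrite finset.setUC.
Qed.

(** By disjointness each edge of the cut has exactly one end in [A], so it is counted exactly
    once. *)
Lemma sum_edge_cut1 A B : [disjoint A & B] ->
  (\sum_(a in A) #|edge_cut E [set a]%SET B| = #|edge_cut E A B|)%N.
Proof.
move=> dAB; under eq_bigr do rewrite -sum1_card big_mkcond /=.
rewrite exchange_big -sum1_card [RHS]big_mkcond; apply: eq_bigr => e _ /=.
have cut1 a : a \in A -> e \in edge_cut E [set a]%SET B -> e \in edge_cut E A B.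
  move=> aA; rewrite !inE => /andP[-> /exists_inP[u]].
  by rewrite inE => /eqP -> ?; apply/exists_inP; exists a.
case: ifPn => [|ncut]; last first.
  by rewrite big1// => a aA; case: ifPn => // /(cut1 _ aA); rewrite (negPf ncut).
rewrite inE => /andP[eE /exists_inP[u uA /exists_inP[v vB /eqP e_uv]]].
(* Only [u] contributes: another node of [A] on the edge [e] would be [v], which lies in [B]. *)
rewrite (bigD1 u)//= big1 => [|a /andP[aA au]].
  rewrite ifT// inE eE; apply/exists_inP; exists u; rewrite ?set11//.
  by apply/exists_inP; exists v => //; apply/eqP.
rewrite ifF// inE eE; apply/negbTE/exists_inP => -[x]; rewrite inE => /eqP ->.
move=> /exists_inP[y yB /eqP exy].
have : a \in e by rewrite exy set21.
rewrite e_uv !inE (negPf au) => /eqP av.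
by move: (disjointFr dAB aA); rewrite av vB.
Qed.

Lemma sum_degree_gt0 A B : edge_cut E A B != finset.set0 ->
  (0 < \sum_(c in A) degree E c)%N.
Proof.
case/finset.set0Pn => e; rewrite inE => /andP[eE /exists_inP[u uA]].
move=> /exists_inP[v _ /eqP e_uv].
rewrite (bigD1 u)//= ltn_addr// card_gt0; apply/finset.set0Pn; exists e.
by rewrite inE eE e_uv set21.
Qed.

End Graph.

Local Open Scope ring_scope.
Local Open Scope classical_set_scope.

(** * The uniform law on tuples and the weak law of large numbers *)

Section UniformLaw.
Variables (R : realType) (V : finType).
Implicit Types (Q : set (seq V)) (f g : V -> R).

(** [Q] concerns sequences of every length, so that one and the same property can be followed as [n]
    grows. *)
Definition uniform_law n Q : R :=
  #|[set s : n.-tuple V | `[< Q s >]]%SET|%:R / #|V|%:R ^+ n.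

Lemma uniform_law_ge0 n Q : 0 <= uniform_law n Q.
Proof. by rewrite divr_ge0 ?exprn_ge0. Qed.

Lemma le_uniform_law n Q1 Q2 : Q1 `<=` Q2 -> uniform_law n Q1 <= uniform_law n Q2.
Proof.
move=> Q12; rewrite ler_wpM2r ?invr_ge0 ?exprn_ge0// ler_nat subset_leq_card//.
by apply/fintype.subsetP => s; rewrite !inE; exact: Q12.
Qed.

Lemma uniform_lawU n Q1 Q2 :
  uniform_law n (Q1 `|` Q2) <= uniform_law n Q1 + uniform_law n Q2.
Proof.
rewrite -mulrDl ler_wpM2r ?invr_ge0 ?exprn_ge0// -natrD ler_nat.
apply: leq_trans (leq_card_setU _ _); apply: subset_leq_card.
apply/fintype.subsetP => s; rewrite !inE => -[] Qs; apply/orP; [left|right];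
  exact/asboolP.
Qed.

(* A property of samples is in this filter when its probability under the
   uniform law tends to 1, so that convergence along it is convergence in
   probability, to which the general limit theorems for filters apply. *)
Definition asymptotically_almost_surely : set_system (seq V) :=
  [set Q | (fun n => uniform_law n (~` Q)) @ \oo --> (0 : R)].

(** Intersections are handled by subadditivity of the law, larger sets by its monotonicity. *)
Global Instance aas_filter : Filter asymptotically_almost_surely.
Proof.
have null_le Q1 Q2 : (fun n => uniform_law n Q2) @ \oo --> (0 : R) ->
    (forall n, uniform_law n Q1 <= uniform_law n Q2) ->
    (fun n => uniform_law n Q1) @ \oo --> (0 : R).
  move=> Q20 Q12; apply: (squeeze_cvgr _ (cvg_cst 0) Q20).
  by apply: nearW => n; rewrite uniform_law_ge0 Q12.
split.
- rewrite /asymptotically_almost_surely/= setCT.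
  rewrite (_ : (fun n => _) = cst 0); first exact: cvg_cst.
  apply/funext => n; rewrite /uniform_law (_ : [set s | _]%SET = finset.set0) ?cards0 ?mul0r//.
  by apply/setP => s; rewrite !inE; apply/negP; rewrite inE.
- move=> Q1 Q2 Q10 Q20; rewrite /asymptotically_almost_surely/= setCI.
  have Q120 := cvgD (FF := eventually_filter) Q10 Q20; rewrite addr0 in Q120.
  apply: (squeeze_cvgr _ (cvg_cst 0) Q120).
  by apply: nearW => n; rewrite uniform_law_ge0 uniform_lawU.
- move=> Q1 Q2 Q12 Q10; apply: null_le Q10 _ => n.
  by apply: le_uniform_law; apply: subsetC.
Qed.

Lemma big_tuple_cons n (F : n.+1.-tuple V -> R) :
  \sum_s F s = \sum_v \sum_(s : n.-tuple V) F (cons_tuple v s).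
Proof.
rewrite pair_big/= (reindex (fun p : V * n.-tuple V => cons_tuple p.1 p.2))//=.
exists (fun s => (thead s, behead_tuple s)) => [[v s]|s] _ /=.
  by congr pair; apply: val_inj.
by rewrite [RHS]tuple_eta.
Qed.

(* The cross terms vanish since g is centred. *)
Lemma second_moment_centred n g : \sum_v g v = 0 ->
  #|V|%:R * \sum_(s : n.-tuple V) (\sum_(v <- s) g v) ^+ 2
  = n%:R * #|V|%:R ^+ n * \sum_v g v ^+ 2.
Proof.
move=> g0; elim: n => [|n IHn].
  rewrite big1 ?mulr0 ?mul0r// => s _.
  by rewrite tuple0 big_nil expr0n.
rewrite big_tuple_cons.
under eq_bigr => v _.
  under eq_bigr do rewrite big_cons sqrrD.
  rewrite !big_split/= sumr_const card_tuple -mulr_sumr; over.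
rewrite !big_split/= sumr_const sumrMnl -mulr_suml g0 mul0r !addr0.
rewrite -[X in _ + X]mulr_natl mulrDr IHn -[_ *+ (_ ^ _)]mulr_natr natrX exprS -natr1; ring.
Qed.

Definition sample_mean f (s : seq V) : R := (\sum_(v <- s) f v) / (size s)%:R.

Definition population_mean f : R := (\sum_v f v) / #|V|%:R.

(** The factor [harmonic n] is 1/(n+1), the inverse of the sample size, and its coefficient is the
    population variance over [e ^+ 2]. *)
Lemma chebyshev_uniform_law n f (e : R) : 0 < e ->
  uniform_law n.+1 [set s | e < `|population_mean f - sample_mean f s|]
  <= (\sum_v (f v - population_mean f) ^+ 2) / #|V|%:R / e ^+ 2 * harmonic n.
Proof.
move=> e0; set m := population_mean f; set Q := [set s | _]; set g := fun v => f v - m.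
(* For empty [V] both sides are 0, since division by 0 gives 0. *)
have [V0|V_gt0] := posnP #|V|.
  by rewrite /uniform_law V0 expr0n/= invr0 !(mulr0, mul0r).
have N0 : (#|V|%:R : R) != 0 by rewrite pnatr_eq0 -lt0n.
have n0 : (n.+1%:R : R) != 0 by rewrite pnatr_eq0.
have g0 : \sum_v g v = 0.
  by rewrite sumrB sumr_const -[m *+ _]mulr_natr divfK ?subrr.
have devE (s : n.+1.-tuple V) :
    \sum_(v <- s) g v = n.+1%:R * (sample_mean f s - m).
  rewrite sumrB big_const_seq iter_addr_0 count_predT size_tuple /sample_mean.
  by rewrite size_tuple -mulr_natl; field.
have /(congr1 (fun x => x / #|V|%:R)) := second_moment_centred n.+1 g0.
rewrite mulrC mulKf// => M2.
(* Markov's inequality by counting: every tuple in [Q] contributes at least [(n.+1%:R * e) ^+ 2] to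
   the second moment, and the others contribute nonnegative terms. *)
have cheb : #|[set s : n.+1.-tuple V | `[< Q s >]]%SET|%:R * (n.+1%:R * e) ^+ 2
    <= \sum_(s : n.+1.-tuple V) (\sum_(v <- s) g v) ^+ 2.
  rewrite mulr_natl -sumr_const; set D := (X in mem X).
  rewrite [leRHS](bigID [in D])/=.
  rewrite -[leLHS]addr0 lerD ?sumr_ge0// => [|s _]; last exact: sqr_ge0.
  apply: ler_sum => s; rewrite !inE /Q/= => /ltW es.
  rewrite devE !exprMn ler_wpM2l ?sqr_ge0// -(real_normK (num_real (_ - m))) distrC.
  by rewrite lerXn2r ?nnegrE// ltW.
rewrite /uniform_law ler_pdivrMr ?exprn_gt0 ?ltr0n//.
rewrite -(@ler_pM2r _ ((n.+1%:R * e) ^+ 2)) ?exprn_gt0 ?mulr_gt0//.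
apply: le_trans cheb _; rewrite M2 /harmonic/= le_eqVlt; apply/orP; left.
by apply/eqP; field; rewrite N0 nat1r n0 gt_eqF.
Qed.

Lemma weak_law_large_numbers f :
  sample_mean f @ asymptotically_almost_surely --> population_mean f.
Proof.
apply/cvgrPdist_le => e e0; rewrite nearE /asymptotically_almost_surely/=.
(* The shift discards the empty sample, as the Chebyshev bound covers sizes [n.+1] only. *)
rewrite -(cvg_shiftS _ (nbhs (0 : R))).
pose C := (\sum_v (f v - population_mean f) ^+ 2) / #|V|%:R / e ^+ 2.
rewrite (_ : ~` _ = [set s | e < `|population_mean f - sample_mean f s|]).
  have bound0 : (fun n => C * harmonic n) @ \oo --> (0 : R).
    rewrite -[X in _ --> X](mulr0 C).
    by apply: cvgM; [exact: cvg_cst|exact: cvg_harmonic].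
  apply: (squeeze_cvgr _ (cvg_cst 0) bound0).
  by apply: nearW => n; rewrite uniform_law_ge0 chebyshev_uniform_law.
by apply/seteqP; split=> s /=; [move=> /negP|move=> ?; apply/negP]; rewrite -real_ltNge ?num_real.
Qed.

End UniformLaw.

(** * From independent uniform draws to the uniform law *)

Section UniformIndependenceSample.
Context (V : finType) (d : measure_display) (T : measurableType d) (R : realType).
Variables (P : probability T R) (n : nat) (S : T -> n.-tuple V).
Hypothesis uisS : uniform_independence_sample P S.

Let sample_eventE (s : n.-tuple V) : S @^-1` [set s] =
  \bigcap_(i in [set` [set: 'I_n]%SET])
    ((fun t => tnth (S t) i) @^-1` [set` [set tnth s i]%SET]).
Proof.
apply/seteqP; split=> t /=; first by move=> <- i _; rewrite /= inE.
move=> St; apply: eq_from_tnth => i.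
by have /= := St i; rewrite !inE => /(_ erefl)/eqP.
Qed.

Lemma measurable_sample_event (s : n.-tuple V) : measurable (S @^-1` [set s]).
Proof.
have [mS _ _] := uisS; rewrite sample_eventE; apply: fin_bigcap_measurable => //.
by move=> i _; exact: mS.
Qed.

Lemma probability_sample_event (s : n.-tuple V) :
  P (S @^-1` [set s]) = ((#|V|%:R ^+ n)^-1)%:E.
Proof.
have [_ uS iS] := uisS.
(* Independence is applied to all indices at once, with singletons as target sets. *)
rewrite sample_eventE (iS _ (fun i => [set tnth s i]%SET)).
under eq_bigr => i _.
  rewrite (_ : [set` [set tnth s i]%SET] = [set tnth s i]); first (rewrite uS; over).
  by apply/seteqP; split=> x /=; rewrite inE => /eqP.
by rewrite prodEFin prodr_const cardsT card_ord exprVn.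
Qed.

(** There are finitely many tuples, so any [Q] gives a finite disjoint union of measurable events of
    equal probability. *)
Lemma probability_sample (Q : set (seq V)) :
  P [set t | Q (S t)] = (uniform_law R n Q)%:E.
Proof.
have -> : [set t | Q (S t)] =
    \bigcup_(s in [set s : n.-tuple V | Q s]) (S @^-1` [set s]).
  apply/seteqP; split=> t /=; first by move=> QS; exists (S t).
  by move=> [s Qs ->].
have finQ : finite_set [set s : n.-tuple V | Q s] by [].
rewrite (measure_fin_bigcup _ finQ); last 2 first.
- by move=> s1 s2 _ _ [t [/= <- <-]].
- by move=> s _; exact: measurable_sample_event.
rewrite (eq_fsbigr (fun=> ((#|V|%:R ^+ n)^-1)%:E)); last first.
  by move=> s _; exact: probability_sample_event.
rewrite fsbig_finite//= sumEFin big_const_seq count_predT iter_addr_0.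
rewrite /uniform_law -[_ *+ size _]mulr_natl.
suff -> : #|[set s : n.-tuple V | `[< Q s >]]%SET| =
          size (finmap.enum_fset (fset_set [set s : n.-tuple V | Q s])) by [].
rewrite cardE; apply/perm_size/uniq_perm; [exact: enum_uniq|exact: finmap.fset_uniq|] => s.
by rewrite mem_enum in_fset_set// inE; apply/idP/idP; rewrite !inE.
Qed.

End UniformIndependenceSample.

(** Only the law of each [S n] enters, so a limit along the filter on sequences transfers to the
    given probability space. *)
Lemma converges_in_probability_sample (V : finType) (d : measure_display)
    (T : measurableType d) (R : realType) (P : probability T R)
    (S : forall n : nat, T -> n.-tuple V)
    (uisS : forall n, uniform_independence_sample P (S n))
    (Phi : seq V -> R) (l : R) :
  Phi @ @asymptotically_almost_surely R V --> l ->
  converges_in_probability P (fun n t => Phi (S n t)) l.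
Proof.
move=> /cvgrPdist_le Phil e /Phil; rewrite nearE /asymptotically_almost_surely/=.
move=> Phie.
under eq_fun => n do rewrite (probability_sample (uisS n) [set s | e < `|Phi s - l|]).
apply: cvg_EFin; first exact: nearW.
rewrite (_ : _ \o _ = (fun n => uniform_law R n (~` [set s | `|l - Phi s| <= e])))//.
apply/funext => n /=; congr (uniform_law _ _ _).
by apply/seteqP; split=> s /=; rewrite distrC real_ltNge ?num_real// => /negP.
Qed.

(** * Limits of the estimators *)

Section Consistency.
Variables (R : realType) (V : finType) (E : {set {set V}}).
Hypothesis simpleE : simple_graph E.
Implicit Types (A B C : {set V}) (F : V -> nat).

Local Notation aas := (@asymptotically_almost_surely R V).

(** A sum over the subsample is a sum over the whole sample of [F] cut off outside [C], to which the
    weak law applies. *)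
Lemma cvg_subsample_sum C F :
  ((\sum_(v <- subsample S C) F v)%N%:R / (size S)%:R : R) @[S --> aas]
  --> ((\sum_(v in C) F v)%N%:R / #|V|%:R : R).
Proof.
have := @weak_law_large_numbers R V (fun v => (if v \in C then F v else 0)%N%:R).
rewrite /population_mean -natr_sum -big_mkcond/= => lln.
rewrite (_ : (fun S => _) = sample_mean (fun v => (if v \in C then F v else 0)%N%:R))//.
by apply/funext => S; rewrite /sample_mean -natr_sum -big_mkcond big_filter.
Qed.

Lemma cvg_sample_sum F :
  ((\sum_(v <- S) F v)%N%:R / (size S)%:R : R) @[S --> aas]
  --> ((\sum_v F v)%N%:R / #|V|%:R : R).
Proof.
have := @weak_law_large_numbers R V (fun v => (F v)%:R).
rewrite /population_mean -natr_sum => lln.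
rewrite (_ : (fun S => _) = sample_mean (fun v => (F v)%:R))//.
by apply/funext => S; rewrite /sample_mean -natr_sum.
Qed.

Lemma cvg_subsample_size C :
  ((size (subsample S C))%:R / (size S)%:R : R) @[S --> aas]
  --> (#|C|%:R / #|V|%:R : R).
Proof.
rewrite -sum1_card; under eq_fun do rewrite -sum1_size.
exact: cvg_subsample_sum.
Qed.

(** The factor [vol E S] cancels, leaving only quantities normalised by [size S], whose limits are
    known. *)
Lemma star_size_estimatorE S C :
  size_estimator R E StarSize S C =
  #|V|%:R * (((\sum_(s <- S) \sum_(v in neighbors E s) (v \in C))%N%:R / (size S)%:R)
    / ((\sum_(v <- subsample S C) degree E v)%N%:R / (size S)%:R)
    * ((size (subsample S C))%:R / (size S)%:R)).
Proof.
rewrite /= /vol_fraction /mean_degree /mean_degree_in -mulrA; congr (_ * _).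
set x := (\sum_(s <- S) _)%N; set y := (\sum_(v <- _) _)%N.
(* If the subsample has total degree 0, both sides are 0 by the convention on division; otherwise
   all the denominators are nonzero. *)
have [->|y0] := eqVneq y 0%N; first by rewrite !(mul0r, invr0, mulr0).
have y_vol : (y <= vol E S)%N.
  by rewrite /y /vol big_filter big_mkcond leq_sum// => v _; case: ifP.
have vol0 : (vol E S)%:R != 0 :> R.
  by rewrite pnatr_eq0 -lt0n (leq_trans _ y_vol)// lt0n.
have S0 : (size S)%:R != 0 :> R.
  rewrite pnatr_eq0; apply: contraNneq y0 => /size0nil S0.
  by rewrite /y S0 big_nil.
have C0 : (size (subsample S C))%:R != 0 :> R.
  rewrite pnatr_eq0; apply: contraNneq y0 => /size0nil C0.
  by rewrite /y C0 big_nil.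
by field; rewrite S0 C0 vol0 pnatr_eq0 y0.
Qed.

Lemma cvg_size_estimator k C : (0 < \sum_(c in C) degree E c)%N ->
  size_estimator R E k S C @[S --> aas] --> (#|C|%:R : R).
Proof.
move=> vol_gt0.
have vol0 : (\sum_(c in C) degree E c)%N%:R != 0 :> R by rewrite pnatr_eq0 -lt0n.
have V0 : #|V|%:R != 0 :> R.
  rewrite pnatr_eq0 -lt0n; have [C0|[v _]] := set_0Vmem C.
    by rewrite C0 big_set0 in vol_gt0.
  by apply/card_gt0P; exists v.
rewrite -[#|C|%:R](divfK V0) mulrC; case: k.
  by apply: cvgM; [exact: cvg_cst|exact: cvg_subsample_size].
rewrite (funext (star_size_estimatorE ^~ C)).
apply: cvgM; first exact: cvg_cst.
rewrite -[X in _ --> X]mul1r; apply: cvgM; last exact: cvg_subsample_size.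
have vol1 : (\sum_(c in C) degree E c)%N%:R / #|V|%:R != 0 :> R.
  by rewrite mulf_neq0 ?invr_neq0.
(* Numerator and denominator both tend to the volume of [C] over [#|V|], so their quotient tends to
   1. *)
rewrite -[X in _ --> X](divff vol1); apply: cvgM; last first.
  by apply: cvgV => //; exact: cvg_subsample_sum.
rewrite -(sum_neighbors_in simpleE); exact: cvg_sample_sum.
Qed.

Lemma edge_weight_estimatorE kA kB A B S :
  edge_weight_estimator R E kA kB A B S =
  ((\sum_(a <- subsample S A) #|edge_cut E [set a]%SET B|)%N%:R / (size S)%:R
   + (\sum_(b <- subsample S B) #|edge_cut E [set b]%SET A|)%N%:R / (size S)%:R)
  / ((size (subsample S A))%:R / (size S)%:R * size_estimator R E kB S B
     + (size (subsample S B))%:R / (size S)%:R * size_estimator R E kA S A).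
Proof.
(* On the empty sample [size S] cannot be cancelled, but both numerators vanish. *)
have [->|S0] := eqVneq S [::].
  by rewrite /edge_weight_estimator /subsample /= !big_nil !(mul0r, addr0).
have n0 : (size S)%:R != 0 :> R by rewrite pnatr_eq0 size_eq0.
rewrite /edge_weight_estimator natrD -mulrDl ![_ / (size S)%:R * _]mulrAC.
by rewrite -mulrDl invfM invrK mulrA mulrAC divfK.
Qed.

Lemma cvg_edge_weight_estimator kA kB A B :
  A != finset.set0 -> B != finset.set0 -> [disjoint A & B]%B ->
  edge_weight_estimator R E kA kB A B S @[S --> aas] --> edge_weight R E A B.
Proof.
move=> A0 B0 dAB; have [cut0|cut0] := eqVneq (edge_cut E A B) finset.set0.
  have cut1 (C D : {set V}) a : edge_cut E C D = finset.set0 -> a \in C ->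
      #|edge_cut E [set a]%SET D| = 0%N.
    move=> CD0 aC; apply/eqP; rewrite cards_eq0 -finset.subset0 -CD0.
    apply/fintype.subsetP => e; rewrite !inE => /andP[-> /exists_inP[u]].
    by rewrite inE => /eqP -> aD; apply/exists_inP; exists a.
  rewrite /edge_weight cut0 cards0 mul0r.
  rewrite (_ : (fun S => _) = cst 0); first exact: cvg_cst.
  apply/funext => S; rewrite /edge_weight_estimator !big_filter !big1 ?mul0r//.
    by move=> b; apply: cut1; rewrite edge_cutC.
  by move=> a; apply: cut1.
have volA := sum_degree_gt0 cut0.
have volB : (0 < \sum_(c in B) degree E c)%N.
  by apply: (sum_degree_gt0 (B := A)); rewrite edge_cutC.
have a0 : #|A|%:R != 0 :> R by rewrite pnatr_eq0 cards_eq0.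
have b0 : #|B|%:R != 0 :> R by rewrite pnatr_eq0 cards_eq0.
have V0 : #|V|%:R != 0 :> R.
  by rewrite pnatr_eq0 -lt0n; case/finset.set0Pn: A0 => v _; apply/card_gt0P; exists v.
rewrite (funext (edge_weight_estimatorE kA kB A B)).
have den0 : #|A|%:R / #|V|%:R * #|B|%:R + #|B|%:R / #|V|%:R * #|A|%:R != 0 :> R.
  rewrite (_ : _ + _ = 2 * (#|A|%:R * #|B|%:R / #|V|%:R)); last by field.
  by rewrite !mulf_neq0 ?invr_neq0 ?(pnatr_eq0 _ 2).
(* The target is rewritten term by term as the limit of the normalised estimator; the common factor
   2 over [#|V|] cancels. *)
rewrite (_ : edge_weight R E A B =
  (#|edge_cut E A B|%:R / #|V|%:R + #|edge_cut E B A|%:R / #|V|%:R)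
  / (#|A|%:R / #|V|%:R * #|B|%:R + #|B|%:R / #|V|%:R * #|A|%:R)); last first.
  rewrite /edge_weight (edge_cutC E B A) -mulr2n -mulr_natl.
  rewrite (_ : _ + _ = 2 * (#|A|%:R * #|B|%:R / #|V|%:R)); last by field.
  by field; rewrite a0 b0 V0.
apply: cvgM.
  rewrite -(sum_edge_cut1 _ dAB) -(sum_edge_cut1 E (A := B) (B := A)) 1?disjoint_sym//.
  by apply: cvgD; exact: cvg_subsample_sum.
apply: cvgV => //.
by apply: cvgD; apply: cvgM; [exact: cvg_subsample_size|exact: cvg_size_estimator
  |exact: cvg_subsample_size|exact: cvg_size_estimator].
Qed.

End Consistency.

Theorem mainTheorem4
  (V : finType) (E : {set {set V}}) (hE : simple_graph E)
  (CC : {set {set V}}) (hCC : finset.partition CC [set: V]%SET)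
  (A B : {set V}) (hA : A \in CC) (hB : B \in CC) (hAB : A <> B)
  (R : realType) (d : measure_display) (T : measurableType d)
  (P : probability T R)
  (S : forall n : nat, T -> n.-tuple V)
  (hS : forall n : nat, uniform_independence_sample P (S n))
  (kA kB : size_formula) :
  converges_in_probability P
    (fun (n : nat) (t : T) => edge_weight_estimator R E kA kB A B (S n t))
    (edge_weight R E A B).
Proof.
(* Blocks of a partition are nonempty and pairwise disjoint, which yields the side conditions on [A]
   and [B]. *)
have /and3P[_ /finset.trivIsetP tCC CC0] := hCC.
apply: (converges_in_probability_sample hS).
apply: cvg_edge_weight_estimator => //.
- by apply: contraNneq CC0 => <-.
- by apply: contraNneq CC0 => <-.
- by apply: tCC => //; apply/eqP.
Qed.
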